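(* Let $G$ be a max stable df and let $F$ be a df with $\lim_{n\to\infty}F^n(a_nx+b_n)=G(x)$, $x\in\mathbb{R}$, for some $a_n>0$, $b_n\in\mathbb{R}$. Let $m\ge1$ and $r\ge 1$ be integers, let $X_1,X_2,\dots$ be iid with df $F$, and for each $n$ let $N_n$ be independent of $X_1,X_2,\dots$ and shifted negative binomial: $P(N_n=l)=\binom{l-m+r-1}{l-m}p_n^rq_n^{l-m}$, $l=m,m+1,m+2,\dots$, where $0<p_n<1$, $q_n=1-p_n$ and $\lim_{n\to\infty}np_n=1$. Then for every fixed integer $k$ with $1\le k\le m$ and every $x$ with $G(x)>0$, $$\lim_{n\to\infty}F_{k:N_n}(a_nx+b_n)=\sum_{l=0}^{k-1}\binom{l+r-1}{l}\frac{1}{(1-\ln G(x))^r}\left(\frac{-\ln G(x)}{1-\ln G(x)}\right)^l.$$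
   Context: df means distribution function on $\mathbb{R}$. $F_{k:N_n}(x)=P(X_{N_n-k+1:N_n}\le x)=\sum_{s}\sum_{i=0}^{k-1}\binom{s}{i}F^{s-i}(x)(1-F(x))^iP(N_n=s)$ is the df of the $k$-th largest among $X_1,\dots,X_{N_n}$. A max stable df is a df of the form $x\mapsto G_0(Ax+B)$ with $A>0$, $B\in\mathbb{R}$ and $G_0$ one of: $\Phi_\alpha(x)=\exp(-x^{-\alpha})$ for $x>0$ and $0$ for $x\le 0$; $\Psi_\alpha(x)=\exp(-|x|^{\alpha})$ for $x<0$ and $1$ for $x\ge 0$ ($\alpha>0$); $\Lambda(x)=\exp(-e^{-x})$. The convention $0^0=1$ is used. *)

(* Defs.v *)
From mathcomp Require Import all_boot all_order all_algebra.
From mathcomp Require Import finmap all_classical all_reals all_analysis.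

Set Implicit Arguments.
Unset Strict Implicit.
Unset Printing Implicit Defensive.

Import Order.TTheory GRing.Theory Num.Theory.
Import numFieldNormedType.Exports.

Local Open Scope classical_set_scope.
Local Open Scope ring_scope.

Section MaxStable.
Context {R : realType}.

Definition frechet (alpha x : R) : R :=
  if 0 < x then expR (- (x `^ (- alpha))) else 0.

Definition weibull (alpha x : R) : R :=
  if x < 0 then expR (- (`|x| `^ alpha)) else 1.

Definition gumbel (x : R) : R := expR (- expR (- x)).

Definition extreme_value_df (G0 : R -> R) : Prop :=
  (exists2 alpha, 0 < alpha & G0 = frechet alpha) \/
  (exists2 alpha, 0 < alpha & G0 = weibull alpha) \/
  G0 = gumbel.

Definition max_stable (G : R -> R) : Prop :=
  exists (G0 : R -> R) (A B : R),
    [/\ extreme_value_df G0, 0 < A & G = fun x => G0 (A * x + B)].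

End MaxStable.

Section OrderStatistics.
Context {R : realType}.

(* [order_stat x s j] is x_{j:s}, the j-th smallest (1 <= j <= s) of the first
   s terms of the sequence x, which is indexed from 0: the term written x_i in
   the usual 1-based notation is [x i.-1]. *)
Definition order_stat (x : nat -> R) (s j : nat) : R :=
  nth 0 (sort <=%R (mkseq x s)) j.-1.

Context d (T : measurableType d) (P : probability T R).

(* P(X_{N-k+1:N} <= x), the df of the k-th largest of X_1, ..., X_N; it is
   meaningful when 1 <= k <= N almost surely. *)
Definition kth_largest_df (X : nat -> {RV P >-> R}) (N : {RV P >-> nat})
    (k : nat) (x : R) : \bar R :=
  P [set w | order_stat (fun i => X i w) (N w) (N w - k + 1)%N <= x].

End OrderStatistics.

Section Independence.
Context {R : realType} d (T : measurableType d) (P : probability T R).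

Definition mutually_independent (X : nat -> {RV P >-> R}) : Prop :=
  forall (J : {fset nat}) (B : nat -> set R),
    (forall i, measurable (B i)) ->
    P (\bigcap_(i in [set` J]) (X i @^-1` B i)) =
    (\prod_(i <- J) P (X i @^-1` B i))%E.

Definition iid_with_df (X : nat -> {RV P >-> R}) (F : R -> R) : Prop :=
  mutually_independent X /\ forall i x, cdf (X i) x = (F x)%:E.

Definition generated_sigma_algebra (X : nat -> {RV P >-> R}) : set (set T) :=
  <<s \bigcup_i [set X i @^-1` B | B in measurable] >>.

Definition independent_of_sequence (N : {RV P >-> nat})
    (X : nat -> {RV P >-> R}) : Prop :=
  forall (A : set nat) (E : set T),
    measurable A -> generated_sigma_algebra X E ->
    P (N @^-1` A `&` E) = (P (N @^-1` A) * P E)%E.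

(* The masses displayed sum to 1 when 1 <= r and 0 < p < 1, hence N >= m almost
   surely. *)
Definition shifted_negative_binomial (m r : nat) (p : R) (N : {RV P >-> nat})
    : Prop :=
  forall l, (m <= l)%N ->
    P [set w | N w = l] =
    ('C(l - m + r - 1, l - m)%:R * p ^+ r * (1 - p) ^+ (l - m))%:E.

End Independence.

(* Main.v *)
(** Write N = m + M, where M is negative binomial, and put v = 1 - F(a_n x + b_n).
    Given N, the number of the X_i exceeding the level a_n x + b_n is binomial
    (N, v), and the k-th largest is below the level iff fewer than k exceed it.
    Exceedances are split into those among m of the variables and those among
    the other M (Vandermonde); summing out M with the negative binomial series
    shows that the latter number is again negative binomial, with success
    probability p / (p + q v).  Since F^n(a_n x + b_n) -> G(x) > 0 gives
    n v -> -ln G(x), this probability tends to 1 / (1 - ln G(x)), while the m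
    remaining variables contribute no exceedance in the limit. *)
Require Import Defs.
From mathcomp Require Import all_boot all_order all_algebra.
From mathcomp Require Import finmap all_classical all_reals all_analysis.
From mathcomp Require Import ring lra zify.

Import Order.TTheory GRing.Theory Num.Theory.
Import numFieldNormedType.Exports.

Local Open Scope classical_set_scope.
Local Open Scope ring_scope.

Set Implicit Arguments.
Unset Strict Implicit.
Unset Printing Implicit Defensive.

(** * Negative binomial series *)

(** Induction on [r] from the geometric series. Pascal's rule links the partial sums of consecutive
    orders, so the limit [L] of the new ones solves [L = (1 - z) ^- r.+1 + z * L]; its existence
    comes from monotone convergence. *)
Lemma negative_binomial_series (R : realType) (r : nat) (z : R) :
  0 <= z < 1 ->
  series (fun t => 'C(t + r, r)%:R * z ^+ t) @ \oo --> (1 - z) ^- r.+1.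
Proof.
move=> /andP[z0 z1]; have z1N : 0 < 1 - z by rewrite subr_gt0.
elim: r => [|r IH].
  rewrite expr1 -[X in _ --> X]mul1r.
  have -> : (fun t => 'C(t + 0, 0)%:R * z ^+ t) = geometric 1 z.
    by apply/funext => t; rewrite bin0.
  by apply: cvg_geometric_series; rewrite ger0_norm.
set S := series _ in IH; set S' := series _.
have S'S n : S' n.+1 = S n.+1 + z * S' n.
  rewrite /S' /S /series /= !big_mkord big_distrr/= big_ord_recl.
  rewrite [X in _ = X + _]big_ord_recl !add0n !binn -addrA; congr (_ + _).
  rewrite -big_split/=; apply: eq_bigr => i _; rewrite /bump /= !add1n.
  by rewrite [(i.+1 + r.+1)%N]addSn binS natrD exprS addSnnS; ring.
have S'0 n : 0 <= S' n.
  by apply: sumr_ge0 => i _; rewrite mulr_ge0 ?exprn_ge0.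
have ndS : nondecreasing_seq S.
  apply/nondecreasing_seqP => n; rewrite /S /series /= big_nat_recr//= lerDl.
  by rewrite mulr_ge0 ?exprn_ge0.
have ndS' : nondecreasing_seq S'.
  apply/nondecreasing_seqP => n; rewrite /S' /series /= big_nat_recr//= lerDl.
  by rewrite mulr_ge0 ?exprn_ge0.
have cS' : cvgn S'.
  (* The bound comes from [S' n <= S' n.+1 = S n.+1 + z * S' n], that is [(1 - z) * S' n <= S n.+1],
     where [S n.+1] is at most its limit. *)
  apply: nondecreasing_is_cvgn => //; exists ((1 - z) ^- r.+1 / (1 - z)).
  move=> _ [n _ <-]; rewrite ler_pdivlMr//.
  have := nondecreasing_cvgn_le ndS (cvgP _ IH) n.+1.
  rewrite (cvg_lim _ IH)//; apply: le_trans.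
  have := ndS' _ _ (leqnSn n); rewrite S'S; lra.
have SS : [sequence S n.+1]_n @ \oo --> (1 - z) ^- r.+1 by rewrite cvg_shiftS.
have : [sequence S' n.+1]_n @ \oo --> (1 - z) ^- r.+1 + z * limn S'.
  have -> : [sequence S' n.+1]_n = (fun n => S n.+1 + z * S' n).
    by apply/funext => n /=; rewrite S'S.
  apply: cvgD => //.
  exact: (cvgM (cvg_cst z) cS').
rewrite cvg_shiftS => h; have e := cvg_lim (@Rhausdorff R) h.
suff -> : (1 - z) ^- r.+2 = limn S' by [].
rewrite exprS invfM; apply: (mulfI (lt0r_neq0 z1N)).
rewrite mulrA divff ?lt0r_neq0// mul1r mulrBl mul1r {1}e; ring.
Qed.

Lemma cvg_series_shift (R : realType) (m : nat) (f : nat -> R) (l : R) :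
  series (fun t => f (m + t)%N) @ \oo --> l ->
  series f @ \oo --> \sum_(0 <= s < m) f s + l.
Proof.
move=> fl; rewrite -(cvg_shiftn m).
have -> : [sequence series f (n + m)%N]_n =
    fun n => \sum_(0 <= s < m) f s + series (fun t => f (m + t)%N) n.
  apply/funext => n; rewrite /series /= addnC.
  rewrite (big_cat_nat _ (leq_addr n m))//=; congr (_ + _).
  rewrite -{1}[m]add0n big_addn addKn.
  by apply: eq_bigr => i _; rewrite addnC.
by apply: cvgD => //; exact: cvg_cst.
Qed.

Lemma cvg_series_shift0 (R : realType) (m : nat) (f : nat -> R) (l : R) :
  (forall s, (s < m)%N -> f s = 0) ->
  series (fun t => f (m + t)%N) @ \oo --> l -> series f @ \oo --> l.
Proof.
by move=> f0 /cvg_series_shift; rewrite big_nat big1 ?add0r.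
Qed.

(** Both sides are the trinomial coefficient [(l + t + r)! / (l! t! r!)]; the proof clears the
    factorials in the denominators. *)
Lemma mul_bin_trinomial (l t r : nat) :
  ('C(l + t, l) * 'C(l + t + r, l + t) = 'C(l + r, l) * 'C(t + (l + r), l + r))%N.
Proof.
have f_gt0 : (0 < l`! * t`! * ((l + t)`! * r`!) * (l + r)`!)%N.
  by rewrite !muln_gt0 !fact_gt0.
apply/eqP; rewrite -(eqn_pmul2r f_gt0).
have e1 : ('C(l + t, l) * (l`! * t`!) = (l + t)`!)%N.
  by rewrite -[in RHS](bin_fact (leq_addr t l)) addKn.
have e2 : ('C(l + t + r, l + t) * ((l + t)`! * r`!) = (l + t + r)`!)%N.
  by rewrite -[in RHS](bin_fact (leq_addr r (l + t))) addKn.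
have e3 : ('C(l + r, l) * (l`! * r`!) = (l + r)`!)%N.
  by rewrite -[in RHS](bin_fact (leq_addr r l)) addKn.
have e4 : ('C(t + (l + r), l + r) * ((l + r)`! * t`!) = (l + t + r)`!)%N.
  rewrite [(l + t + r)%N](_ : _ = (t + (l + r))%N); last ring.
  by rewrite -[in RHS](bin_fact (leq_addl t (l + r))) addnK.
apply/eqP; transitivity ((l + t)`! * (l + t + r)`! * (l + r)`!)%N.
  by rewrite -e1 -e2 -{1}e1; ring.
by rewrite -{1}e3 -e4; ring.
Qed.

(** For [q = 1 - p] and [v = 1 - u] this is thinning: each of a negative binomial number of items is
    marked with probability [v], and the sum is the probability of [l] marks. The trinomial identity
    moves [t] into a single coefficient, leaving a negative binomial series of order [l + r] in
    [u * q]. *)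
Lemma thinned_negative_binomial_series (R : realType) (r l : nat) (p q u v : R) :
  0 <= u * q < 1 ->
  series (fun t => 'C(t, l)%:R * u ^+ (t - l) * v ^+ l *
    ('C(t + r, t)%:R * p ^+ r.+1 * q ^+ t)) @ \oo -->
  'C(l + r, l)%:R * (p / (1 - u * q)) ^+ r.+1 * (v * q / (1 - u * q)) ^+ l.
Proof.
move=> uq; apply: (@cvg_series_shift0 _ l) => [s sl|].
  by rewrite bin_small// !mul0r.
pose c := 'C(l + r, l)%:R * p ^+ r.+1 * (v * q) ^+ l.
have -> : 'C(l + r, l)%:R * (p / (1 - u * q)) ^+ r.+1 *
    (v * q / (1 - u * q)) ^+ l = c * (1 - u * q) ^- (l + r).+1.
  rewrite /c -addnS exprD invfM !exprMn !exprVn; ring.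
have -> : series (fun t => 'C(l + t, l)%:R * u ^+ (l + t - l) * v ^+ l *
    ('C(l + t + r, l + t)%:R * p ^+ r.+1 * q ^+ (l + t))) =
    cst c \* series (fun t => 'C(t + (l + r), l + r)%:R * (u * q) ^+ t).
  apply/funext => n; rewrite /series /= big_distrr/=; apply: eq_bigr => t _.
  transitivity (('C(l + t, l) * 'C(l + t + r, l + t))%:R *
     (u ^+ t * v ^+ l * p ^+ r.+1 * q ^+ (l + t))).
    by rewrite natrM addKn; ring.
  by rewrite mul_bin_trinomial natrM /c !exprMn exprD; ring.
by apply: cvgM; [exact: cvg_cst|exact: negative_binomial_series].
Qed.

(* The probability of at most k - 1 (not k) failures among s trials, u being the
   probability of success. *)
Definition binomial_cdf (R : realType) (u : R) (s k : nat) : R :=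
  \sum_(0 <= i < k) 'C(s, i)%:R * u ^+ (s - i) * (1 - u) ^+ i.

(** Vandermonde's identity with the powers distributed. The bound [i <= m] keeps the truncated
    subtractions exact; terms with [t < i - j] vanish through their binomial coefficient. *)
Lemma binomial_convolution (R : realType) (m t i : nat) (u v : R) : (i <= m)%N ->
  'C(m + t, i)%:R * u ^+ (m + t - i) * v ^+ i =
  \sum_(j < i.+1) 'C(m, j)%:R * u ^+ (m - j) * v ^+ j *
    ('C(t, i - j)%:R * u ^+ (t - (i - j)) * v ^+ (i - j)).
Proof.
move=> im; rewrite -binomial.Vandermonde natr_sum !big_distrl/=.
apply: eq_bigr => j _; have ji : (j <= i)%N by rewrite -ltnS.
have [tij|ijt] := ltnP t (i - j).
  by rewrite (bin_small tij) muln0 !mul0r mulr0.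
have -> : (m + t - i = m - j + (t - (i - j)))%N by lia.
have -> : v ^+ i = v ^+ j * v ^+ (i - j) by rewrite -exprD subnKC.
by rewrite natrM exprD; ring.
Qed.

(* j counts the exceedances among m variables and i - j those among the other M;
   r stands for the paper's r - 1. *)
Definition mixture_df (R : realType) (m r k : nat) (p u : R) : R :=
  \sum_(0 <= i < k) \sum_(j < i.+1) 'C(m, j)%:R * u ^+ (m - j) * (1 - u) ^+ j *
    ('C(i - j + r, i - j)%:R * (p / (1 - u * (1 - p))) ^+ r.+1 *
     ((1 - u) * (1 - p) / (1 - u * (1 - p))) ^+ (i - j)).

Lemma mixture_series (R : realType) (m r k : nat) (p u : R) :
  (k <= m)%N -> 0 < p < 1 -> 0 <= u <= 1 ->
  series (fun t => 'C(t + r, t)%:R * p ^+ r.+1 * (1 - p) ^+ t *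
    binomial_cdf u (m + t) k) @ \oo --> mixture_df m r k p u.
Proof.
move=> km /andP[p0 p1] /andP[u0 u1].
have uq : 0 <= u * (1 - p) < 1 by apply/andP; split; nra.
pose f i j := cst ('C(m, j)%:R * u ^+ (m - j) * (1 - u) ^+ j) \*
  series (fun t => 'C(t, i - j)%:R * u ^+ (t - (i - j)) * (1 - u) ^+ (i - j) *
    ('C(t + r, t)%:R * p ^+ r.+1 * (1 - p) ^+ t)).
(* Only finitely many pairs [(i, j)] occur, so the sum over [t] can be taken inside and its limit
   computed pair by pair. *)
rewrite [X in X @ _](_ : _ = fun n => \sum_(0 <= i < k) \sum_(j < i.+1) f i j n).
  apply: (cvg_big add_continuous) => i _.
  apply: (cvg_big add_continuous) => j _.
  by apply: cvgM; [exact: cvg_cst|exact: thinned_negative_binomial_series].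
apply/funext => n; rewrite /series /=.
transitivity (\sum_(0 <= t < n) \sum_(0 <= i < k) \sum_(j < i.+1)
   'C(m, j)%:R * u ^+ (m - j) * (1 - u) ^+ j *
   ('C(t, i - j)%:R * u ^+ (t - (i - j)) * (1 - u) ^+ (i - j) *
    ('C(t + r, t)%:R * p ^+ r.+1 * (1 - p) ^+ t))).
  apply: eq_bigr => t _; rewrite big_distrr/= big_nat [RHS]big_nat.
  apply: eq_bigr => i /andP[_ ik].
  rewrite binomial_convolution ?(leq_trans (ltnW ik))// big_distrr/=.
  by apply: eq_bigr => j _; ring.
rewrite exchange_big/=; apply: eq_bigr => i _; rewrite exchange_big/=.
by apply: eq_bigr => j _; rewrite /f /= /series /= big_distrr.
Qed.

(** * Limits *)

Lemma cvg0_of_rate (R : realType) (w : nat -> R) (l : R) :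
  (fun n => n%:R * w n) @ \oo --> l -> w @ \oo --> (0 : R).
Proof.
set v := (X in X @ _ --> l -> _) => vl; rewrite -(cvg_shiftS w).
have -> : [sequence w n.+1]_n =
    harmonic \* [sequence v n.+1]_n.
  by apply/funext => n /=; rewrite /v mulKf.
suff : harmonic \* [sequence v n.+1]_n @ \oo --> 0 * l.
  by rewrite mul0r.
have vlS : [sequence v n.+1]_n @ \oo --> l.
  by rewrite cvg_shiftS.
exact: cvgM cvg_harmonic vlS.
Qed.

(** Taking logarithms gives the rate for [- ln (u n)]; it passes to [1 - u n] through the sandwich
    [- u ln u <= 1 - u <= - ln u] once [u n] is known to tend to 1. *)
Lemma tail_rate (R : realType) (u : nat -> R) (g : R) : 0 < g ->
  (forall n, 0 <= u n <= 1) -> (fun n => u n ^+ n) @ \oo --> g ->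
  (fun n => n%:R * (1 - u n)) @ \oo --> - ln g.
Proof.
move=> g0 u01 ug.
(* If [u n] were 0 with [n] positive, then [u n ^+ n] would be 0, while it is eventually positive
   because its limit is. *)
have u0 : \forall n \near \oo, 0 < u n.
  near=> n; have : 0 < u n ^+ n by near: n; exact: (cvgr_gt _ ug).
  have n0 : (0 < n)%N by near: n; exact: nbhs_infty_gt.
  have /andP[] := u01 n; rewrite le_eqVlt => /predU1P[<-|//].
  by rewrite expr0n gtn_eqF// ltxx.
have lnu : (fun n => n%:R * - ln (u n)) @ \oo --> - ln g.
  apply: cvg_trans (cvgN (continuous_cvg _ (continuous_ln g0) ug)).
  apply: near_eq_cvg; near=> n => /=.
  by rewrite -[LHS]/(- ln (u n ^+ n)) lnXn ?mulrN ?mulr_natl//; near: n.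
have ub : \forall n \near \oo, 1 - u n <= - ln (u n).
  near=> n; have un0 : 0 < u n by near: n.
  have : ln (1 + (u n - 1)) <= u n - 1 by apply: le_ln1Dx; lra.
  by rewrite addrC subrK; lra.
(* The inequality [ln (1 + x) <= x] again, now at [x = 1 / u n - 1], then multiplied by [u n]. *)
have lb : \forall n \near \oo, u n * - ln (u n) <= 1 - u n.
  near=> n; have un0 : 0 < u n by near: n.
  have : ln (1 + ((u n)^-1 - 1)) <= (u n)^-1 - 1.
    by apply: le_ln1Dx; rewrite ltrBrDl subrr invr_gt0.
  rewrite addrC subrK lnV// => h.
  apply: le_trans (ler_wpM2l (ltW un0) h) _.
  by rewrite mulrBr divff ?gt_eqF// mulr1.
have v0 : (fun n => 1 - u n) @ \oo --> (0 : R).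
  apply: (squeeze_cvgr _ (cvg_cst 0) (cvg0_of_rate lnu)).
  near=> n; have /andP[_ un1] := u01 n.
  by apply/andP; split; [rewrite subr_ge0|near: n].
have u1 : u @ \oo --> (1 : R).
  rewrite [u](_ : _ = fun n => 1 - (1 - u n)); last first.
    by apply/funext => n; rewrite subKr.
  by rewrite -[X in _ --> X]subr0; apply: cvgB => //; exact: cvg_cst.
have lim1 : (fun n => u n * (n%:R * - ln (u n))) @ \oo --> - ln g.
  by rewrite -[X in _ --> X]mul1r; exact: cvgM.
apply: (squeeze_cvgr _ lim1 lnu); near=> n; apply/andP; split.
  by rewrite mulrCA ler_wpM2l//; near: n.
by rewrite ler_wpM2l//; near: n.
Unshelve. all: by end_near. Qed.

Lemma mixture_df_cvg (R : realType) (m r k : nat) (p u : nat -> R) (tau : R) :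
  0 <= tau -> (fun n => n%:R * p n) @ \oo --> (1 : R) ->
  (fun n => n%:R * (1 - u n)) @ \oo --> tau ->
  (fun n => mixture_df m r k (p n) (u n)) @ \oo -->
  \sum_(0 <= i < k) 'C(i + r, i)%:R * (1 / (1 + tau)) ^+ r.+1 *
    (tau / (1 + tau)) ^+ i.
Proof.
move=> tau0 np nv.
have p0 := cvg0_of_rate np; have v0 := cvg0_of_rate nv.
have q1 : (fun n => 1 - p n) @ \oo --> (1 : R).
  by rewrite -[X in _ --> X]subr0; apply: cvgB => //; exact: cvg_cst.
have u1 : u @ \oo --> (1 : R).
  rewrite [u](_ : _ = fun n => 1 - (1 - u n)); last first.
    by apply/funext => n; rewrite subKr.
  by rewrite -[X in _ --> X]subr0; apply: cvgB => //; exact: cvg_cst.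
(* Uses the splitting [1 - u (1 - p) = u p + (1 - u)], whose two terms have rates 1 and [tau]. *)
have den : (fun n => n%:R * (1 - u n * (1 - p n))) @ \oo --> 1 + tau.
  rewrite [X in X @ _](_ : _ = fun n => u n * (n%:R * p n) + n%:R * (1 - u n)).
    apply: cvgD => //; rewrite -[X in _ --> X]mul1r; exact: cvgM.
  by apply/funext => n; ring.
have tau1 : 1 + tau != 0 by rewrite gt_eqF// ltr_pwDl.
have denV : (fun n => (n%:R * (1 - u n * (1 - p n)))^-1) @ \oo --> (1 + tau)^-1.
  exact: cvgV.
(* Numerator and denominator both tend to 0, so each is scaled by [n]. *)
have cvg_quotient (w : nat -> R) (l : R) : (fun n => n%:R * w n) @ \oo --> l ->
    (fun n => w n / (1 - u n * (1 - p n))) @ \oo --> l / (1 + tau).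
  move=> wl; apply: cvg_trans (cvgM wl denV).
  apply: near_eq_cvg; near=> n => /=.
  have n0 : n%:R != 0 :> R.
    by rewrite pnatr_eq0 -lt0n; near: n; exact: nbhs_infty_gt.
  by rewrite invfM mulrACA divff// mul1r.
have succ : (fun n => p n / (1 - u n * (1 - p n))) @ \oo --> 1 / (1 + tau).
  exact: cvg_quotient.
have fail : (fun n => (1 - u n) * (1 - p n) / (1 - u n * (1 - p n))) @ \oo -->
    tau / (1 + tau).
  apply: cvg_quotient; rewrite -[X in _ --> X]mulr1.
  rewrite [X in X @ _](_ : _ = (fun n => n%:R * (1 - u n)) \* (fun n => 1 - p n)).
    exact: cvgM.
  by apply/funext => n /=; rewrite mulrA.
have cvg_pow (w : nat -> R) (l : R) e :
    w @ \oo --> l -> (fun n => w n ^+ e) @ \oo --> l ^+ e.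
  by move=> wl; apply: (continuous_cvg _ (@exprn_continuous R e l) wl).
(* The target is first written as the double sum with [u] replaced by 1 and [1 - u] by 0, so that
   limits can be taken term by term. Only [j = 0] survives, by [0 ^+ 0 = 1]. *)
rewrite [X in _ --> X](_ : _ = \sum_(0 <= i < k) \sum_(j < i.+1)
    'C(m, j)%:R * 1 ^+ (m - j) * 0 ^+ j *
    ('C(i - j + r, i - j)%:R * (1 / (1 + tau)) ^+ r.+1 *
      (tau / (1 + tau)) ^+ (i - j))); last first.
  apply: eq_bigr => i _; rewrite big_ord_recl /= big1 => [|j _].
    by rewrite !subn0 bin0 expr1n expr0 !mul1r addr0.
  by rewrite /= [0 ^+ _]exprS mul0r mulr0 mul0r.
apply: (cvg_big add_continuous) => i _.
apply: (cvg_big add_continuous) => j _.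
apply: cvgM.
  apply: cvgM; last exact: cvg_pow.
  by apply: cvgM; [exact: cvg_cst|exact: cvg_pow].
by apply: cvgM; [apply: cvgM; [exact: cvg_cst|exact: cvg_pow]|exact: cvg_pow].
Unshelve. all: by end_near. Qed.

(** * Order statistics and exceedances *)

Section ExceedancePattern.
Context {R : realType} {T : Type}.
Implicit Types (Y : nat -> T -> R) (y : R) (s : nat) (w : T).

Definition exceedances Y s y w : {set 'I_s} := finset (fun j : 'I_s => y < Y j w).

(** Defined on all of [nat] to match the family of Borel sets in [mutually_independent]; only its
    values at indices below [s] enter the fibers. *)
Definition pattern_side s (J : {set 'I_s}) y (i : nat) : set R :=
  if i \in map val (enum J) then `]y, +oo[%classic else `]-oo, y]%classic.

Lemma pattern_side_ord s (J : {set 'I_s}) y (j : 'I_s) :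
  pattern_side J y j = if j \in J then `]y, +oo[%classic else `]-oo, y]%classic.
Proof. by rewrite /pattern_side mem_map ?mem_enum//; exact: val_inj. Qed.

Lemma exceedances_fiber Y s y (J : {set 'I_s}) :
  exceedances Y s y @^-1` [set J] =
  \bigcap_(i in `I_s) (Y i @^-1` pattern_side J y i).
Proof.
apply/seteqP; split => [w /= <- i /= si|w /= Jw].
  rewrite (pattern_side_ord _ _ (Ordinal si)) inE /=.
  by case: ltP => h /=; rewrite in_itv/= ?andbT.
apply/finset.setP => j; rewrite inE.
have := Jw j (ltn_ord j); rewrite /= pattern_side_ord.
by case: ifP => _ /=; rewrite in_itv/= ?andbT// leNgt => /negbTE.
Qed.

(** With 0-based [i], the sorted entry at [i] is at most [y] iff more than [i] values are at most
    [y]. Sorting preserves counts, and values on the two sides of [y] total [s]. *)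
Lemma order_stat_le Y s i y w : (i < s)%N ->
  (nth 0 (sort <=%R (mkseq (Y^~ w) s)) i <= y) =
  (#|exceedances Y s y w| < s - i)%N.
Proof.
move=> si; set x := Y^~ w; set srt := sort _ _.
have srtd : sorted <=%R srt by apply: sort_sorted; exact: le_total.
have szs : size srt = s by rewrite size_sort size_mkseq.
have cardE : #|exceedances Y s y w| = count (fun z => ~~ (z <= y)) srt.
  rewrite /srt count_sort /mkseq count_map -val_enum_ord count_map.
  rewrite [LHS]cardE [in LHS]/enum_mem size_filter -enumT.
  by apply: eq_count => j /=; rewrite inE -ltNge.
have cnt : (count (<= y)%R srt + #|exceedances Y s y w| = s)%N.
  by rewrite cardE -[RHS]szs -(count_predC (<= y)%R).
apply/idP/idP => [|h].
  apply: contraLR; rewrite -leqNgt -ltNge => h.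
  apply: nth_count_gt => //; rewrite szs si andbT.
  by rewrite -(leq_add2r #|exceedances Y s y w|) cnt -leq_subLR.
apply: nth_count_le => //.
by rewrite -(ltn_add2r #|exceedances Y s y w|) cnt -ltn_subRL.
Qed.

Lemma order_stat_le_bigcup Y s i y : (i < s)%N ->
  [set w | nth 0 (sort <=%R (mkseq (Y^~ w) s)) i <= y] =
  \bigcup_(J in [set J : {set 'I_s} | (#|J| < s - i)%N])
    (exceedances Y s y @^-1` [set J]).
Proof.
move=> si; apply/seteqP; split => [w /=|w [J /= Ji /= wJ]].
  by rewrite order_stat_le// => h; exists (exceedances Y s y w).
by rewrite order_stat_le// wJ.
Qed.

End ExceedancePattern.

Lemma measurable_pattern_side (R : realType) s (J : {set 'I_s}) (y : R) i :
  measurable (pattern_side J y i).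
Proof. by rewrite /pattern_side; case: ifP. Qed.

Lemma measurable_exceedances_fiber (R : realType) d (T : measurableType d)
    (Y : nat -> T -> R) s y (J : {set 'I_s}) :
  (forall i (B : set R), measurable B -> measurable (Y i @^-1` B)) ->
  measurable (exceedances Y s y @^-1` [set J]).
Proof.
move=> mY; rewrite exceedances_fiber; apply: fin_bigcap_measurable => // i _.
by apply: mY; exact: measurable_pattern_side.
Qed.

(* Stated for an arbitrary measurable structure so as to apply both to the ambient
   sigma-algebra and to the one generated by the sequence. *)
Lemma measurable_order_stat_le (R : realType) d (T : measurableType d)
    (Y : nat -> T -> R) s i y :
  (forall i (B : set R), measurable B -> measurable (Y i @^-1` B)) ->
  measurable [set w | nth 0 (sort <=%R (mkseq (Y^~ w) s)) i <= y].
Proof.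
move=> mY; have [is_|si] := ltnP i s.
  rewrite order_stat_le_bigcup//; apply: fin_bigcup_measurable => // J _.
  exact: measurable_exceedances_fiber.
(* Out of range, [nth] returns its default 0, so the event does not depend on [w]. *)
rewrite (_ : [set w | _] = if 0 <= y then setT else set0).
  by case: ifP => _; [exact: measurableT|exact: measurable0].
apply/seteqP; split => w /=;
  by rewrite nth_default ?size_sort ?size_mkseq//; case: ifP.
Qed.

Lemma sum_subsets_card (R : realType) (n k : nat) (a : nat -> R) :
  (k <= n.+1)%N ->
  \sum_(J : {set 'I_n} | (#|J| < k)%N) a #|J| =
  \sum_(0 <= i < k) 'C(n, i)%:R * a i.
Proof.
move=> kn; transitivity
    (\sum_(0 <= i < k) \sum_(J : {set 'I_n} | #|J| == i) a #|J|).
  rewrite (exchange_big_dep xpredT)//= [LHS]big_mkcond; apply: eq_bigr => J _.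
  rewrite big_mkcond big_nat_cond/=.
  have [Jk|kJ] := ltnP #|J| k.
    rewrite -big_nat_cond (bigD1_seq #|J|) ?iota_uniq//= ?mem_index_iota// eqxx.
    by rewrite big1 ?addr0// => i /negbTE; rewrite eq_sym => ->.
  rewrite big1// => i /andP[ik _].
  by rewrite gtn_eqF// (leq_trans ik).
apply: eq_bigr => i _; rewrite (eq_bigr (fun=> a i)) => [|J /eqP-> //].
rewrite sumr_const -[LHS]mulr_natl; congr (_%:R * _).
rewrite -[n in 'C(n, _)]card_ord -card_draws; apply: eq_card => J.
by rewrite !inE.
Qed.

Section IidOrderStatistics.
Context {R : realType} d (T : measurableType d) (P : probability T R).
Variables (X : nat -> {RV P >-> R}) (F : R -> R).
Hypothesis XF : iid_with_df X F.

Let Y : nat -> T -> R := fun i => X i.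

Let mY i (B : set R) : measurable B -> measurable (Y i @^-1` B).
Proof. by move=> mB; rewrite -[_ @^-1` _]setTI; exact: measurable_funP. Qed.

Lemma probability_preimage_le i y : P (Y i @^-1` `]-oo, y]) = (F y)%:E.
Proof. exact: XF.2. Qed.

Lemma probability_preimage_gt i y : P (Y i @^-1` `]y, +oo[) = (1 - F y)%:E.
Proof.
rewrite EFinB -(probability_preimage_le i) -probability_setC; last exact: mY.
by rewrite preimage_setC setCitvl.
Qed.

Lemma df_ge0_le1 y : 0 <= F y <= 1.
Proof.
rewrite -!lee_fin -(probability_preimage_le 0 y) measure_ge0/=.
by apply: probability_le1; exact: mY.
Qed.

Lemma probability_exceedances_fiber s y (J : {set 'I_s}) :
  P (exceedances Y s y @^-1` [set J]) =
  (F y ^+ (s - #|J|) * (1 - F y) ^+ #|J|)%:E.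
Proof.
rewrite exceedances_fiber.
pose A := [fset i in iota 0 s]%fset.
have -> : `I_s = [set` A].
  by apply/seteqP; split => i /=; rewrite !inE/= mem_iota add0n.
rewrite XF.1 => [|i]; last exact: measurable_pattern_side.
have pA : perm_eq A (iota 0 s).
  by apply: uniq_perm; rewrite ?fset_uniq ?iota_uniq// => i; rewrite !inE.
rewrite (perm_big _ pA) -[X in iota _ X]subn0 -/(index_iota 0 s) big_mkord.
transitivity (\prod_(j < s) (if j \in J then 1 - F y else F y)%:E)%E.
  apply: eq_bigr => j _; rewrite pattern_side_ord.
  by case: ifP => _;
    [exact: probability_preimage_gt|exact: probability_preimage_le].
rewrite prodEFin; congr EFin; rewrite (bigID (mem J))/= mulrC; congr (_ * _).
  rewrite (eq_bigr (fun=> F y)) => [|j /negbTE -> //].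
  rewrite prodr_const; congr (_ ^+ _); have := cardC (mem J).
  rewrite card_ord => e; apply: (@addnI #|J|).
  by rewrite subnKC ?e// -[leqRHS]card_ord max_card.
by rewrite (eq_bigr (fun=> 1 - F y)) => [|j -> //]; rewrite prodr_const.
Qed.

Lemma probability_order_stat_le s k y : (0 < k <= s)%N ->
  P [set w | order_stat (Y^~ w) s (s - k + 1) <= y] =
  (binomial_cdf (F y) s k)%:E.
Proof.
(* The 1-based rank [s - k + 1] is position [s - k] from 0, so the event says that fewer than
   [s - (s - k) = k] values exceed [y]. It is a disjoint union over the possible exceedance sets. *)
move=> /andP[k0 ks]; rewrite /order_stat addn1 /=.
rewrite order_stat_le_bigcup ?subKn//; last by rewrite ltn_subrL k0 (leq_trans k0).
rewrite measure_fin_bigcup//.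
- rewrite -(@bigfs _ _ _ _ (index_enum _) (fun J : {set 'I_s} => (#|J| < k)%N)).
  + rewrite (eq_bigr _ (fun J _ => probability_exceedances_fiber y J)).
    rewrite sumEFin (sum_subsets_card (fun c => F y ^+ (s - c) * (1 - F y) ^+ c))//.
    2: exact: leq_trans ks (leqnSn s).
    by congr EFin; apply: eq_bigr => i _; rewrite mulrA.
  + exact: index_enum_uniq.
  + by move=> J _; rewrite mem_index_enum.
- exact: finite_finset.
- by move=> J J' _ _ [w [/= -> ->]].
- by move=> J _; exact: measurable_exceedances_fiber.
Qed.

End IidOrderStatistics.

(** * Random sample size *)

Section RandomSampleSize.
Context {R : realType} d (T : measurableType d) (P : probability T R).
Variables (X : nat -> {RV P >-> R}) (N : {RV P >-> nat}).

Lemma measurable_sample_size s : measurable (N @^-1` [set s]).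
Proof. by rewrite -[_ @^-1` _]setTI; exact: measurable_funP. Qed.

(** Countable additivity over the partition by the values of [N], transferred to real series so that
    the series lemmas above apply. *)
Lemma cvg_sum_sample_size (E : set T) :
  (forall s, measurable (N @^-1` [set s] `&` E)) ->
  series (fun s => fine (P (N @^-1` [set s] `&` E))) @ \oo --> fine (P E).
Proof.
move=> mE.
have tE : trivIset setT (fun s => N @^-1` [set s] `&` E).
  by move=> s t _ _ [w [[/= -> _] [/= <- _]]].
have UE : \bigcup_s (N @^-1` [set s] `&` E) = E.
  by apply/seteqP; split => [w [s _ []]//|w Ew]; exists (N w).
have mUE : measurable E by rewrite -UE; exact: bigcup_measurable.
have := @measure_semi_sigma_additive _ _ _ P _ mE tE.
rewrite UE => /(_ mUE) PE.
have PEfin : EFin \o series (fun s => fine (P (N @^-1` [set s] `&` E))) @ \oo -->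
    (fine (P E))%:E.
  rewrite fineK ?fin_num_measure//.
  rewrite [X in X @ _](_ : _ =
    fun n => (\sum_(0 <= s < n) P (N @^-1` [set s] `&` E))%E)//.
  apply/funext => n; rewrite /series /= -sumEFin.
  by apply: eq_bigr => s _; rewrite fineK ?fin_num_measure.
exact: fine_cvg PEfin.
Qed.

(** The law prescribes masses only from [m] on. They already sum to 1 by the negative binomial
    series, which leaves total mass 0 for the values below [m]. *)
Lemma sample_size_lt_null (m r : nat) (p : R) : 0 < p < 1 ->
  shifted_negative_binomial m r.+1 p N ->
  forall s, (s < m)%N -> P (N @^-1` [set s]) = 0%E.
Proof.
move=> p01 Np; have /andP[p0 p1] := p01.
pose g s := fine (P (N @^-1` [set s] `&` setT)).
have g1 : series g @ \oo --> (1 : R).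
  rewrite -[X in _ --> X]/(fine 1%E) -(@probability_setT _ _ _ P).
  by apply: cvg_sum_sample_size => s; rewrite setIT; exact: measurable_sample_size.
have gm t : g (m + t)%N = 'C(t + r, r)%:R * (1 - p) ^+ t * p ^+ r.+1.
  rewrite /g setIT Np ?leq_addr//= addKn addnS subn1/=.
  by rewrite -bin_sub ?leq_addr// addKn; ring.
have gm1 : series (fun t => g (m + t)%N) @ \oo --> (1 : R).
  have -> : series (fun t => g (m + t)%N) =
      series (fun t => 'C(t + r, r)%:R * (1 - p) ^+ t) \* cst (p ^+ r.+1).
    apply/funext => n; rewrite /series /= big_distrl/=.
    by apply: eq_bigr => t _; exact: gm.
  (* The limit 1 is written as [(1 - (1 - p)) ^- r.+1 * p ^+ r.+1] to match the negative binomial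
     series at [z = 1 - p]. *)
  rewrite -[X in _ --> X](mulVf (_ : p ^+ r.+1 != 0)) ?expf_neq0 ?gt_eqF//.
  rewrite -[X in X ^- _ * _](subKr 1).
  apply: cvgM; last exact: cvg_cst.
  by apply: negative_binomial_series; lra.
have sum_g : \sum_(0 <= s < m) g s = 0.
  have : 1 = \sum_(0 <= s < m) g s + 1.
    exact: (cvg_unique (@Rhausdorff R) g1 (cvg_series_shift gm1)).
  by move/eqP; rewrite -subr_eq subrr => /eqP.
move=> s sm; have g0 i : 0 <= g i by exact: fine_ge0.
have /eqP : g s = 0.
  move/eqP : sum_g; rewrite big_mkord psumr_eq0// => /allP/(_ (Ordinal sm)).
  by rewrite mem_index_enum => /(_ isT)/eqP.
by rewrite /g setIT fine_eq0 ?fin_num_measure//; [move/eqP|exact: measurable_sample_size].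
Qed.

Lemma kth_largest_df_mixture (F : R -> R) (m r k : nat) (p y : R) :
  iid_with_df X F -> independent_of_sequence N X ->
  0 < p < 1 -> shifted_negative_binomial m r.+1 p N -> (0 < k <= m)%N ->
  kth_largest_df X N k y = (mixture_df m r k p (F y))%:E.
Proof.
move=> XF NX p01 Np /andP[k0 km].
pose Y i : T -> R := X i.
have mY i (B : set R) : measurable B -> measurable (Y i @^-1` B).
  by move=> mB; rewrite -[_ @^-1` _]setTI; exact: measurable_funP.
rewrite /kth_largest_df; set E := [set w | _].
pose O s := [set w | order_stat (Y^~ w) s (s - k + 1) <= y].
(* On the event [N = s] the random sample size may be frozen at [s]; the resulting event [O s]
   depends on the sequence alone. *)
have EO s : N @^-1` [set s] `&` E = N @^-1` [set s] `&` O s.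
  by apply/seteqP; split => w [/= Nw]; rewrite /E /O/= Nw.
have mO s : measurable (O s) by exact: measurable_order_stat_le.
have gO s : generated_sigma_algebra X (O s).
  (* Independence of [N] concerns events of the sigma-algebra generated by the sequence, so
     measurability is proved there and not only in the ambient one. *)
  apply: (@measurable_order_stat_le R _ (g_sigma_algebraType
    (\bigcup_i [set X i @^-1` B | B in measurable])) Y) => i B mB.
  by apply: sub_sigma_algebra; exists i => //; exists B.
have mE s : measurable (N @^-1` [set s] `&` E).
  by rewrite EO; apply: measurableI => //; exact: measurable_sample_size.
have mE' : measurable E.
  rewrite (_ : E = \bigcup_s (N @^-1` [set s] `&` E)); first exact: bigcup_measurable.
  by apply/seteqP; split => [w Ew|w [s _ []]//]; exists (N w).
have PE s : P (N @^-1` [set s] `&` E) = (P (N @^-1` [set s]) * P (O s))%E.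
  by rewrite EO NX.
have Elim := cvg_sum_sample_size mE.
suff Emix : series (fun s => fine (P (N @^-1` [set s] `&` E))) @ \oo -->
    mixture_df m r k p (F y).
  by rewrite -(cvg_unique (@Rhausdorff R) Elim Emix) fineK ?fin_num_measure.
apply: (@cvg_series_shift0 _ m) => [s sm|].
  by rewrite PE (sample_size_lt_null p01 Np sm) mul0e.
rewrite [X in series X](_ : _ = fun t =>
    'C(t + r, t)%:R * p ^+ r.+1 * (1 - p) ^+ t * binomial_cdf (F y) (m + t) k).
  by apply: mixture_series => //; exact: df_ge0_le1 XF y.
apply/funext => t; have kmt : (0 < k <= m + t)%N.
  by rewrite k0 (leq_trans km)// leq_addr.
rewrite PE [P (O _)](probability_order_stat_le XF y kmt) Np ?leq_addr//.
by rewrite -EFinM/= addKn addnS subn1.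
Qed.

End RandomSampleSize.

Theorem theorem4p5 (R : realType) (d : measure_display) (T : measurableType d)
    (P : probability T R)
    (G : R -> R) (F : cumulativeBounded (0 : R) (1 : R)) (a b : nat -> R)
    (m r : nat) (X : nat -> {RV P >-> R}) (N : nat -> {RV P >-> nat})
    (p : nat -> R) :
  max_stable G ->
  (forall n, 0 < a n) ->
  (forall x, (fun n => F (a n * x + b n) ^+ n) @ \oo --> G x) ->
  (1 <= m)%N -> (1 <= r)%N ->
  iid_with_df X F ->
  (forall n, independent_of_sequence (N n) X) ->
  (forall n, 0 < p n < 1) ->
  (forall n, shifted_negative_binomial m r (p n) (N n)) ->
  (fun n => n%:R * p n) @ \oo --> (1 : R) ->
  forall k : nat, (1 <= k <= m)%N ->
  forall x : R, 0 < G x ->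
  (fun n => kth_largest_df X (N n) k (a n * x + b n)) @ \oo -->
    (\sum_(0 <= l < k)
       'C(l + r - 1, l)%:R * (1 / (1 - ln (G x)) ^+ r) *
       ((- ln (G x)) / (1 - ln (G x))) ^+ l)%:E.
Proof.
(* As [1 <= r], the parameter is replaced by [r.+1], the form used in the lemmas. *)
move=> _ _ FG _; case: r => // r _ XF NX p01 Np np k km x Gx0.
have F01 n : 0 <= F (a n * x + b n) <= 1 by exact: df_ge0_le1 XF _.
rewrite [X in X @ _](_ : _ =
    EFin \o (fun n => mixture_df m r k (p n) (F (a n * x + b n)))); last first.
  by apply/funext => n; exact: kth_largest_df_mixture.
apply: cvg_EFin; first by near=> n.
rewrite [X in _ --> X](_ : _ = \sum_(0 <= i < k) 'C(i + r, i)%:R *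
    (1 / (1 + - ln (G x))) ^+ r.+1 * ((- ln (G x)) / (1 + - ln (G x))) ^+ i).
  have nv := tail_rate Gx0 F01 (FG x).
  apply: mixture_df_cvg => //.
  (* Nonnegativity of [- ln (G x)] is inherited from the terms [n * (1 - F (a n * x + b n))] that
     converge to it. *)
  apply: (cvgr_to_ge nv); near=> n.
  by rewrite mulr_ge0// subr_ge0; have /andP[] := F01 n.
by apply: eq_bigr => l _; rewrite addnS subn1/= !div1r exprVn.
Unshelve. all: by end_near. Qed.
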